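(* Let $(X,d_X,\mu,T)$ and $(Y,d_Y,\nu,S)$ be compact metric measure-preserving systems. The following are equivalent: (1) $\mathcal J(T,S)/{\sim}=\{[\mu\otimes\nu]\}$, i.e. every $\lambda\in\mathcal J(T,S)$ satisfies $\lambda\sim\mu\otimes\nu$; (2) for every $n,m\ge1$, $\Phi_{n,m}(\mathcal J(T,S))=\{\Phi_{n,m}(\mu\otimes\nu)\}$.
   Context: A compact metric measure-preserving system $(X,d_X,\mu,T)$: $(X,d_X)$ compact metric, $\mu$ Borel probability, $T$ Borel with $T_\#\mu=\mu$; probability spaces standard and completed. $\mathcal J(T,S)$: Borel probability measures on $X\times Y$ with marginals $\mu,\nu$ invariant under $T\times S$. For $z_i=(x_i,y_i)$, $\mathcal D^X_{n,m}=(d_X(T^ax_i,T^bx_j))_{1\le i,j\le n,0\le a,b<m}$, $\mathcal D^Y_{n,m}=(d_Y(S^ay_i,S^by_j))_{1\le i,j\le n,0\le a,b<m}$, $\Phi_{n,m}(\lambda)=\mathrm{Law}_{\lambda^{\otimes n}}(\mathcal D^X_{n,m},\mathcal D^Y_{n,m})$. For $\lambda\in\mathcal J(T,S)$, $\mathcal K_\lambda$ is the marked colored kernel space on $(X\times Y,\lambda)$ with marks $M_X^{a,b}(x,y)=d_X(T^ax,T^bx)$, $M_Y^{a,b}(x,y)=d_Y(S^ay,S^by)$ and kernels $K_X^{a,b}((x,y),(x',y'))=d_X(T^ax,T^bx')$, $K_Y^{a,b}((x,y),(x',y'))=d_Y(S^ay,S^by')$, $a,b\ge0$. In a marked colored kernel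 space, points $z,z'$ are twins if all marks agree and for each kernel $k$, $k(z,w)=k(z',w)$ and $k(w,z)=k(w,z')$ for a.e. $w$; the twin-free quotient $\mathcal K^{\rm tw}$ is the space obtained (modulo null sets) by identifying twins, with pushforward measure and descended marks and kernels. Two marked colored kernel spaces are kernel-isomorphic if a measure-space isomorphism $U$ preserves every mark a.e. and every kernel a.e. on the product. Define $\lambda\sim\lambda'$ iff $\mathcal K_\lambda^{\rm tw}$ and $\mathcal K_{\lambda'}^{\rm tw}$ are kernel-isomorphic; $[\mu\otimes\nu]$ is the class of the product joining. *)

(* Defs.v *)
From HB Require Import structures.
From mathcomp Require Import all_boot all_order all_algebra.
From mathcomp Require Import all_classical all_reals all_analysis.
Set Implicit Arguments. Unset Strict Implicit. Unset Printing Implicit Defensive.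
Import Order.TTheory GRing.Theory Num.Theory.
Import numFieldNormedType.Exports.
Local Open Scope classical_set_scope.
Local Open Scope ring_scope.

Section defs.
Variable R : realType.

Definition is_metric (X : Type) (dX : X -> X -> R) : Prop :=
  [/\ forall x y, 0 <= dX x y,
      forall x y, dX x y = 0 <-> x = y,
      forall x y, dX x y = dX y x &
      forall x y z, dX x z <= dX x y + dX y z].

Definition metric_open (X : Type) (dX : X -> X -> R) (A : set X) : Prop :=
  forall x, A x -> exists e : R, 0 < e /\ [set y | dX x y < e] `<=` A.

Definition metric_compact (X : Type) (dX : X -> X -> R) : Prop :=
  forall u : nat -> X, exists (phi : nat -> nat) (l : X),
    (forall k, (phi k < phi k.+1)%N) /\
    (fun k => dX (u (phi k)) l) @ \oo --> (0 : R).

Definition cmmps d (X : measurableType d) (dX : X -> X -> R)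
  (mu : probability X R) (T : X -> X) : Prop :=
  [/\ is_metric dX, metric_compact dX,
      (@measurable d X) = <<s metric_open dX >>,
      measurable_fun setT T &
      forall A, measurable A -> mu (T @^-1` A) = mu A].

Definition joining d1 d2 (X : measurableType d1) (Y : measurableType d2)
  (mu : probability X R) (nu : probability Y R) (T : X -> X) (S : Y -> Y)
  (lam : probability (X * Y)%type R) : Prop :=
  [/\ forall A, measurable A -> lam (A `*` setT) = mu A,
      forall B, measurable B -> lam (setT `*` B) = nu B &
      forall C, measurable C ->
        lam ((fun z : X * Y => (T z.1, S z.2)) @^-1` C) = lam C].

(** index set of marks / kernels: a colour (true = X, false = Y) and (a,b) *)
Definition idx := (bool * nat * nat)%type.

Record mcks := MCKS {
  mcks_disp : measure_display;
  mcks_car : measurableType mcks_disp;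
  mcks_P : probability mcks_car R;
  mcks_mark : idx -> mcks_car -> R;
  mcks_ker : idx -> mcks_car -> mcks_car -> R }.
Arguments mcks_P : clear implicits.
Arguments mcks_mark : clear implicits.
Arguments mcks_ker : clear implicits.

Definition twins (K : mcks) (z z' : mcks_car K) : Prop :=
  (forall i, mcks_mark K i z = mcks_mark K i z') /\
  (forall i, {ae mcks_P K, forall w,
     mcks_ker K i z w = mcks_ker K i z' w /\
     mcks_ker K i w z = mcks_ker K i w z'}).

Definition twin_free (K : mcks) : Prop :=
  exists N : set (mcks_car K), [/\ measurable N, mcks_P K N = 0%E &
    forall z z', ~ N z -> ~ N z' -> twins z z' -> z = z'].

Definition twin_free_quotient (K Q : mcks) : Prop :=
  [/\ twin_free Q,
      forall i, measurable_fun setT (mcks_mark Q i),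
      forall i, measurable_fun setT
        (fun q : (mcks_car Q * mcks_car Q)%type => mcks_ker Q i q.1 q.2) &
   exists p : mcks_car K -> mcks_car Q,
     [/\ measurable_fun setT p,
         forall A, measurable A -> mcks_P Q A = mcks_P K (p @^-1` A),
         forall i, {ae mcks_P K, forall z, mcks_mark Q i (p z) = mcks_mark K i z} &
         forall i, {ae (mcks_P K \x mcks_P K)%E, forall zw,
           mcks_ker Q i (p zw.1) (p zw.2) = mcks_ker K i zw.1 zw.2}]].

Definition kernel_iso (K K' : mcks) : Prop :=
  exists (U : mcks_car K -> mcks_car K') (V : mcks_car K' -> mcks_car K)
         (A : set (mcks_car K)) (A' : set (mcks_car K')),
  [/\ [/\ measurable A, measurable A', mcks_P K (~` A) = 0%E &
          mcks_P K' (~` A') = 0%E],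
      measurable_fun setT U /\ measurable_fun setT V,
      (forall x, A x -> A' (U x) /\ V (U x) = x) /\
      (forall y, A' y -> A (V y) /\ U (V y) = y),
      forall B, measurable B -> mcks_P K' B = mcks_P K (U @^-1` B) &
      (forall i, {ae mcks_P K, forall x, mcks_mark K' i (U x) = mcks_mark K i x}) /\
      (forall i, {ae (mcks_P K \x mcks_P K)%E, forall xy,
         mcks_ker K' i (U xy.1) (U xy.2) = mcks_ker K i xy.1 xy.2})].

Definition K_of d1 d2 (X : measurableType d1) (Y : measurableType d2)
  (dX : X -> X -> R) (dY : Y -> Y -> R) (T : X -> X) (S : Y -> Y)
  (lam : probability (X * Y)%type R) : mcks :=
  @MCKS _ (X * Y)%type lam
    (fun i z => let: (c, a, b) := i in
       if c then dX (iter a T z.1) (iter b T z.1)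
            else dY (iter a S z.2) (iter b S z.2))
    (fun i z z' => let: (c, a, b) := i in
       if c then dX (iter a T z.1) (iter b T z'.1)
            else dY (iter a S z.2) (iter b S z'.2)).

Definition jequiv d1 d2 (X : measurableType d1) (Y : measurableType d2)
  (dX : X -> X -> R) (dY : Y -> Y -> R) (T : X -> X) (S : Y -> Y)
  (lam lam' : probability (X * Y)%type R) : Prop :=
  exists Q Q' : mcks,
    [/\ twin_free_quotient (K_of dX dY T S lam) Q,
        twin_free_quotient (K_of dX dY T S lam') Q' &
        kernel_iso Q Q'].

(** integral against the n-fold product [lam^{(x) n}], computed as iterated
    integral over the coordinates of an n-tuple *)
Fixpoint iter_int d (Z : measurableType d) (lam : {measure set Z -> \bar R})
  (n : nat) : (n.-tuple Z -> \bar R) -> \bar R :=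
  match n with
  | 0 => fun F => F [tuple]
  | n'.+1 => fun F =>
      (\int[lam]_z iter_int lam (fun t : n'.-tuple Z => F [tuple of z :: t]))%E
  end.

(** index set of the pair of distance matrices (D^X_{n,m}, D^Y_{n,m}):
    (i, a, j, b, colour) with 1 <= i,j <= n encoded as 'I_n, 0 <= a,b < m *)
Definition midx (n m : nat) := ('I_n * 'I_m * 'I_n * 'I_m * bool)%type.

(** the random pair of matrices, flattened to a tuple of reals (coordinates
    listed along the enumeration of [midx n m]) *)
Definition distmat d1 d2 (X : measurableType d1) (Y : measurableType d2)
  (dX : X -> X -> R) (dY : Y -> Y -> R) (T : X -> X) (S : Y -> Y)
  (n m : nat) (z : n.-tuple (X * Y)%type) : #|{: midx n m}|.-tuple R :=
  [tuple let: (i, a, j, b, c) := enum_val k in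
         if c then dX (iter a T (tnth z i).1) (iter b T (tnth z j).1)
              else dY (iter a S (tnth z i).2) (iter b S (tnth z j).2)
   | k < #|{: midx n m}|].
Arguments distmat {d1 d2 X Y} dX dY T S n m z.

Definition Phi d1 d2 (X : measurableType d1) (Y : measurableType d2)
  (dX : X -> X -> R) (dY : Y -> Y -> R) (T : X -> X) (S : Y -> Y)
  (n m : nat) (lam : probability (X * Y)%type R)
  (B : set (#|{: midx n m}|.-tuple R)) : \bar R :=
  iter_int lam (fun z => (\1_(distmat dX dY T S n m @^-1` B) z)%:E).

End defs.
Arguments Phi {R d1 d2 X Y} dX dY T S n m lam B.
Arguments jequiv {R d1 d2 X Y} dX dY T S lam lam'.
Arguments joining {R d1 d2 X Y} mu nu T S lam.
Arguments cmmps {R d X} dX mu T.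

(* Main.v *)
Require Import Defs.
From HB Require Import structures.
From mathcomp Require Import all_boot all_order all_algebra.
From mathcomp Require Import all_classical all_reals all_analysis.
From mathcomp Require Import measurable_realfun ring lra.
Set Implicit Arguments. Unset Strict Implicit. Unset Printing Implicit Defensive.
Import Order.TTheory GRing.Theory Num.Theory.
Import numFieldNormedType.Exports.
Local Open Scope classical_set_scope.
Local Open Scope ring_scope.

(** Twins of [K_lam] are equal off a null set, since a point of the support is
    determined by its distances to almost every point; so [K_lam] is its own
    twin-free quotient, and both conditions turn out to say that
    [lam = mu \x nu] for every joining [lam].

    If the matrix laws agree, let [E] be the set of the points [(x, y)] such that
    [x] lies in finitely many balls centred at the [x]-coordinates of sample
    points and [y] in finitely many balls centred at the [y]-coordinates of other
    sample points.  With [a = lam E] and [b = (mu \x nu) E], the integrals over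
    the centres of [a^2], [a b] and [b^2] are probabilities of events on the
    distance matrices (use four extra sample points), hence all equal to the
    value of the last one under [mu \x nu].  So the integral of [(a - b)^2]
    vanishes and [a = b] for almost all centres, then for all centres in the
    supports by moving the centres and shrinking the radii, and a pi-system
    argument gives [lam = mu \x nu].

    Conversely, the matrix law is invariant under measure preserving maps that
    preserve marks and kernels almost everywhere. *)

(** * Iterated integrals *)

Section iterated.
Context {R : realType} {d : measure_display} {Z : measurableType d}.
Variable lam : probability Z R.
Local Open Scope ereal_scope.

Lemma iter_int_ge0 n (F : n.-tuple Z -> \bar R) :
  (forall t, 0 <= F t) -> 0 <= iter_int lam F.
Proof.
by elim: n F => [|n IH] F F0 //=; apply: integral_ge0 => z _; exact: IH.
Qed.

Lemma measurable_tuple_cons n (z : Z) :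
  measurable_fun [set: n.-tuple Z] (fun t : n.-tuple Z => [tuple of z :: t]).
Proof. exact: (@measurable_cons _ _ _ _ (cst z) n id). Qed.

(** The parameter space [W] stays arbitrary because the induction absorbs the head of the tuple into
    it; Fubini-Tonelli then gives measurability after that coordinate is integrated out. *)
Lemma measurable_iter_int d' (W : measurableType d') n
    (F : W * n.-tuple Z -> \bar R) :
  measurable_fun setT F -> (forall x, 0 <= F x) ->
  measurable_fun setT (fun w => iter_int lam (fun t => F (w, t))).
Proof.
elim: n d' W F => [|n IH] d' W F mF F0 /=.
  exact: (measurableT_comp mF (measurable_pair2 _)).
pose F' (wzt : (W * Z) * n.-tuple Z) := F (wzt.1.1, [tuple of wzt.1.2 :: wzt.2]).
have mF' : measurable_fun setT F'.
  apply: (measurableT_comp mF); apply: measurable_fun_pair => /=.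
    exact: measurableT_comp.
  by apply: (@measurable_cons _ _ _ _ (snd \o fst) n snd) => //; exact: measurableT_comp.
apply: (measurable_fun_fubini_tonelli_F (m2 := lam)
  (fun wz : W * Z => iter_int lam (fun t => F' (wz, t)))).
  by apply: (IH _ _ F') => // x; exact: F0.
by move=> x; apply: iter_int_ge0 => t; exact: F0.
Qed.

Lemma measurable_iter_int_cons n (F : n.+1.-tuple Z -> \bar R) :
  measurable_fun setT F -> (forall x, 0 <= F x) ->
  measurable_fun setT
    (fun z => iter_int lam (fun t : n.-tuple Z => F [tuple of z :: t])).
Proof.
move=> mF F0.
apply: (@measurable_iter_int _ Z n (fun zt => F [tuple of zt.1 :: zt.2])) => //.
by apply: (measurableT_comp mF); exact: (@measurable_cons _ _ _ _ fst n snd).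
Qed.

Lemma measurable_cons_comp n (F : n.+1.-tuple Z -> \bar R) z :
  measurable_fun setT F ->
  measurable_fun setT (fun t : n.-tuple Z => F [tuple of z :: t]).
Proof. by move=> mF; apply: (measurableT_comp mF); exact: measurable_tuple_cons. Qed.

Lemma iter_intD n (F G : n.-tuple Z -> \bar R) :
  measurable_fun setT F -> measurable_fun setT G ->
  (forall t, 0 <= F t) -> (forall t, 0 <= G t) ->
  iter_int lam (fun t => F t + G t) = iter_int lam F + iter_int lam G.
Proof.
elim: n F G => [|n IH] F G mF mG F0 G0 //=.
rewrite -ge0_integralD//.
- by apply: eq_integral => z _; apply: IH => //; exact: measurable_cons_comp.
- by move=> z _; exact: iter_int_ge0.
- exact: measurable_iter_int_cons.
- by move=> z _; exact: iter_int_ge0.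
- exact: measurable_iter_int_cons.
Qed.

Lemma iter_int_cat n m (F : (n + m).-tuple Z -> \bar R) :
  iter_int lam F =
  iter_int lam (fun u : n.-tuple Z =>
    iter_int lam (fun v : m.-tuple Z => F [tuple of u ++ v])).
Proof.
elim: n F => [|n IH] F /=.
  by congr iter_int; apply/funext => v; congr F; exact: val_inj.
apply: eq_integral => z _; rewrite IH; congr iter_int; apply/funext => u.
by congr iter_int; apply/funext => v; congr F; exact: val_inj.
Qed.

(** Independence of the sample points. Once the centres are fixed, it turns the event on the extra
    sample points into a product of measures. *)
Lemma iter_int_prod_indic n (A : 'I_n -> set Z) :
  (forall i, measurable (A i)) ->
  iter_int lam (fun t : n.-tuple Z => (\prod_(i < n) \1_(A i) (tnth t i))%:E)
  = (\prod_(i < n) fine (lam (A i)))%:E.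
Proof.
elim: n A => [|n IH] A mA /=; first by rewrite !big_ord0.
rewrite big_ord_recl.
transitivity (\int[lam]_z ((\1_(A ord0) z)%:E *
   (\prod_(i < n) fine (lam (A (lift ord0 i))))%:E)).
  apply: eq_integral => z _.
  rewrite -(IH (fun i => A (lift ord0 i)))//.
  have [zA|zA] := boolP (z \in A ord0).
    rewrite indicE zA mul1e; congr iter_int; apply/funext => t.
    rewrite big_ord_recl /= indicE (_ : tnth _ ord0 = z)// zA mul1r.
    by congr EFin; apply: eq_bigr => i _; rewrite tnthS.
  rewrite indicE (negbTE zA) mul0e.
  rewrite [X in iter_int _ X](_ : _ = fun=> 0).
    by elim: (n) => //= k IHk; rewrite IHk integral0.
  apply/funext => t; rewrite big_ord_recl /= indicE (_ : tnth _ ord0 = z)//.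
  by rewrite (negbTE zA) mul0r.
rewrite ge0_integralZr//.
- by rewrite integral_indic// setIT EFinM fineK// fin_num_measure.
- by apply/measurable_EFinP; exact: measurable_indic.
- by rewrite lee_fin; apply: prodr_ge0 => i _; exact: fine_ge0.
Qed.

(** Almost everywhere for the n-fold product, taken one coordinate at a time to match the recursion
    of [iter_int]; [P] may be non-measurable. *)
Fixpoint iter_ae n : (n.-tuple Z -> Prop) -> Prop :=
  match n with
  | 0 => fun P => P [tuple]
  | n'.+1 => fun P =>
      {ae lam, forall z, iter_ae (fun t : n'.-tuple Z => P [tuple of z :: t])}
  end.

Lemma iter_ae_sub n (P Q : n.-tuple Z -> Prop) :
  (forall t, P t -> Q t) -> iter_ae P -> iter_ae Q.
Proof.
elim: n P Q => [|n IH] P Q PQ /=; first exact: PQ.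
by apply: filterS => z; apply: IH => t; exact: PQ.
Qed.

Lemma iter_ae_forall n (I : finType) (P : I -> n.-tuple Z -> Prop) :
  (forall i, iter_ae (P i)) -> iter_ae (fun t => forall i, P i t).
Proof.
elim: n P => [|n IH] P iP //=.
have : {ae lam, forall z, forall i, iter_ae (fun t : n.-tuple Z => P i [tuple of z :: t])}.
  by apply: filter_forall => i; exact: iP.
by apply: filterS => z; exact: IH.
Qed.

Lemma iter_ae_all n (P : n.-tuple Z -> Prop) : (forall t, P t) -> iter_ae P.
Proof.
elim: n P => [|n IH] P aP //=.
by apply: nearW => z; apply: IH.
Qed.

Lemma iter_ae_tnth n (i : 'I_n) (P : Z -> Prop) :
  {ae lam, forall z, P z} -> iter_ae (fun t : n.-tuple Z => P (tnth t i)).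
Proof.
move=> aeP; elim: n i => [|n IH] i /=; first by case: i.
case: (unliftP ord0 i) => [j ->|->]; last first.
  by apply: filterS aeP => z Pz; exact: iter_ae_all.
apply: nearW => z; apply: iter_ae_sub (IH j) => t.
by rewrite tnthS.
Qed.

Lemma ae_xsection (P : Z -> Z -> Prop) :
  {ae (lam \x lam), forall zw, P zw.1 zw.2} ->
  {ae lam, forall z, {ae lam, forall w, P z w}}.
Proof.
move=> [N [mN N0 PN]].
have : {ae lam, forall z, lam (xsection N z) = 0}.
  have /(ae_eq_integral_abs lam measurableT (measurable_fun_xsection lam mN)) :
      \int[lam]_z `|(lam \o xsection N) z| = 0.
    rewrite -N0; apply: eq_integral => z _.
    by rewrite gee0_abs//=.
  by apply: filterS => z /(_ Logic.I).
apply: filterS => z Nz; exists (xsection N z); split => //.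
  exact: measurable_xsection.
by move=> w /= nP; rewrite /xsection /= inE; exact: PN.
Qed.

Lemma ae_ysection (P : Z -> Z -> Prop) :
  {ae (lam \x lam), forall zw, P zw.1 zw.2} ->
  {ae lam, forall z, {ae lam, forall w, P w z}}.
Proof.
move=> [N [mN N0 PN]].
(* Integration in the other order defines the same measure, since both agree on rectangles, so [N]
   is null for it too. *)
have N0' : (lam \x^ lam) N = 0.
  rewrite -N0; apply/esym; apply: product_measure_unique => // A B mA mB.
  exact: product_measure2E.
have : {ae lam, forall z, lam (ysection N z) = 0}.
  have /(ae_eq_integral_abs lam measurableT (measurable_fun_ysection lam mN)) :
      \int[lam]_z `|(lam \o ysection N) z| = 0.
    rewrite -N0'; apply: eq_integral => z _.
    by rewrite gee0_abs//=.
  by apply: filterS => z /(_ Logic.I).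
apply: filterS => z Nz; exists (ysection N z); split => //.
  exact: measurable_ysection.
by move=> w /= nP; rewrite /ysection /= inE; exact: PN.
Qed.

(** The later of the two coordinates runs through a section at the earlier one, in the first or the
    second variable according to the order of [i] and [j]. Distinctness matters: the diagonal may be
    null in the square. *)
Lemma iter_ae_tnth2 n (i j : 'I_n) (P : Z -> Z -> Prop) : i != j ->
  {ae (lam \x lam), forall zw, P zw.1 zw.2} ->
  iter_ae (fun t : n.-tuple Z => P (tnth t i) (tnth t j)).
Proof.
move=> + aeP; elim: n i j => [|n IH] i j ij /=; first by case: i ij.
case: (unliftP ord0 i) ij => [i' ->|->]; case: (unliftP ord0 j) => [j' ->|->] //.
- rewrite (inj_eq lift_inj) => /IH Pij.
  by apply: nearW => z; apply: iter_ae_sub Pij => t; rewrite !tnthS.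
- move=> _; apply: filterS (ae_ysection aeP) => z /(iter_ae_tnth i').
  by apply: iter_ae_sub => t; rewrite tnthS.
- move=> _; apply: filterS (ae_xsection aeP) => z /(iter_ae_tnth j').
  by apply: iter_ae_sub => t; rewrite tnthS.
Qed.

Lemma ae_eq_iter_int n (F G : n.-tuple Z -> \bar R) :
  measurable_fun setT F -> measurable_fun setT G ->
  (forall t, 0 <= F t) -> (forall t, 0 <= G t) ->
  iter_ae (fun t => F t = G t) -> iter_int lam F = iter_int lam G.
Proof.
elim: n F G => [|n IH] F G mF mG F0 G0 //= FG.
apply: ge0_ae_eq_integral => //.
- exact: measurable_iter_int_cons.
- exact: measurable_iter_int_cons.
- by move=> z _; exact: iter_int_ge0.
- by move=> z _; exact: iter_int_ge0.
- by apply: filterS FG => z FG _; apply: IH => //; exact: measurable_cons_comp.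
Qed.

Lemma iter_int_eq0 n (F : n.-tuple Z -> \bar R) :
  measurable_fun setT F -> (forall t, 0 <= F t) ->
  iter_int lam F = 0 -> iter_ae (fun t => F t = 0).
Proof.
elim: n F => [|n IH] F mF F0 //= iF0.
have /(ae_eq_integral_abs lam measurableT (measurable_iter_int_cons mF F0)) :
    \int[lam]_z `|iter_int lam (fun t : n.-tuple Z => F [tuple of z :: t])| = 0.
  by rewrite -iF0; apply: eq_integral => z _; rewrite gee0_abs// iter_int_ge0.
apply: filterS => z /(_ Logic.I) /= h; apply: IH => //.
exact: measurable_cons_comp.
Qed.

Lemma iter_int_le1 n (F : n.-tuple Z -> \bar R) :
  measurable_fun setT F -> (forall t, 0 <= F t) -> (forall t, F t <= 1) ->
  iter_int lam F <= 1.
Proof.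
elim: n F => [|n IH] F mF F0 F1 //=.
rewrite -[leRHS](probability_setT lam) -[leRHS]mul1e -(integral_cst lam measurableT 1).
apply: ge0_le_integral => //.
- by move=> z _; exact: iter_int_ge0.
- exact: measurable_iter_int_cons.
- by move=> z _; apply: IH => //; exact: measurable_cons_comp.
Qed.

Lemma ae_meets (V P : Z -> Prop) : measurable (V : set Z) -> lam V != 0 ->
  {ae lam, forall z, P z} -> exists z, V z /\ P z.
Proof.
move=> mV V0 [N [mN N0 PN]]; apply: contrapT => /forallNP noz.
move/eqP: V0; apply; apply: subset_measure0 N0 => //.
by move=> z Vz; apply: PN => Pz; exact: (noz z).
Qed.

(** The coordinates are picked in turn, each from a set of positive measure. This moves given
    centres to nearby ones at which an almost sure identity holds. *)
Lemma iter_ae_meets n (V : 'I_n -> set Z) (P : n.-tuple Z -> Prop) :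
  (forall i, measurable (V i)) -> (forall i, lam (V i) != 0) ->
  iter_ae P -> exists t, (forall i, V i (tnth t i)) /\ P t.
Proof.
elim: n V P => [|n IH] V P mV V0 /=; first by move=> P0; exists [tuple]; split => // -[].
move=> /(ae_meets (mV ord0) (V0 ord0))[z [Vz]].
move=> /(IH (fun i => V (lift ord0 i)))[//|//|t [Vt Pt]].
exists [tuple of z :: t]; split => // i.
by case: (unliftP ord0 i) => [j ->|->]; rewrite ?tnthS.
Qed.

End iterated.

Lemma iter_int_pushforward {R : realType} {d d' : measure_display}
    {Z : measurableType d} {Z' : measurableType d'}
    (P : probability Z R) (P' : probability Z' R) (p : Z -> Z') :
  measurable_fun setT p ->
  (forall A, measurable A -> P' A = P (p @^-1` A)) ->
  forall n (F : n.-tuple Z' -> \bar R),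
  measurable_fun setT F -> (forall t, 0 <= F t)%E ->
  iter_int P' F = iter_int P (fun t : n.-tuple Z => F [tuple of map p t]).
Proof.
move=> mp PP'; elim => [|n IH] F mF F0 /=.
  by congr F; exact: val_inj.
rewrite (eq_measure_integral (pushforward P p)); last by move=> A mA _; exact: PP'.
rewrite ge0_integral_pushforward//; last by move=> z _; exact: iter_int_ge0.
  apply: eq_integral => z _ /=; rewrite IH//; last exact: measurable_cons_comp.
  by congr iter_int; apply/funext => t; congr F; exact: val_inj.
exact: measurable_iter_int_cons.
Qed.

(** * Balls in a compact metric measure space *)

Definition inv_succ {R : realType} (n : nat) : R := n.+1%:R^-1.

Lemma inv_succ_gt0 (R : realType) n : 0 < inv_succ n :> R.
Proof. by rewrite invr_gt0. Qed.

Lemma inv_succ_lt (R : realType) (e : R) : 0 < e -> exists n, inv_succ n < e.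
Proof.
move=> e0; exists (Num.trunc e^-1).
by rewrite /inv_succ -[ltRHS]invrK ltf_pV2 ?posrE ?invr_gt0// truncnS_gt.
Qed.

Section metric.
Context {R : realType} {d : measure_display} {X : measurableType d}.
Variable dX : X -> X -> R.
Hypothesis metX : is_metric dX.
Hypothesis cptX : metric_compact dX.
Hypothesis borX : @measurable d X = <<s metric_open dX >>.

(** Otherwise a greedy choice of points at distance at least [e] from all earlier ones gives a
    sequence without a convergent subsequence. *)
Lemma metric_net (x0 : X) (e : R) : 0 < e ->
  exists l : seq X, forall x, exists2 i, (i < size l)%N & dX x (nth x0 l i) < e.
Proof.
have [_ _ sym tri] := metX.
move=> e0; apply: contrapT => /forallNP noL.
have /choice[f fP] : forall l : seq X, exists x,
    forall i, (i < size l)%N -> e <= dX x (nth x0 l i).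
  move=> l; have /existsNP[x xP] := noL l; exists x => i il.
  by rewrite leNgt; apply/negP => xi; apply: xP; exists i.
pose L := fix L n := if n is k.+1 then rcons (L k) (f (L k)) else [::].
have sizeL n : size (L n) = n by elim: n => //= n; rewrite size_rcons => ->.
have nthL i n : (i < n)%N -> nth x0 (L n) i = f (L i).
  elim: n => // n IH; rewrite ltnS leq_eqVlt => /orP[/eqP->|lt_in] /=.
    by rewrite nth_rcons sizeL ltnn eqxx.
  by rewrite nth_rcons sizeL lt_in IH.
have far i n : (i < n)%N -> e <= dX (f (L n)) (f (L i)).
  by move=> lt_in; rewrite -(nthL i n lt_in); apply: fP; rewrite sizeL.
have [phi [l [phiS /cvgr0Pnorm_lt cvg]]] := cptX (fun n => f (L n)).
(* Two consecutive terms of the subsequence within [e / 2] of the limit are closer than [e]. *)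
have e2 : 0 < e / 2 by rewrite divr_gt0.
have [N _ HN] := cvg _ e2.
have /= h1 := HN N (leqnn N); have /= h2 := HN N.+1 (leqnSn N).
have := far _ _ (phiS N); apply/negP; rewrite -ltNge.
apply: le_lt_trans (tri _ l _) _; rewrite (sym l) [ltRHS](splitr e).
by apply: ltrD; [apply: le_lt_trans h2|apply: le_lt_trans h1]; exact: ler_norm.
Qed.

Lemma metric_separable (x0 : X) :
  exists s : nat -> X, forall x (e : R), 0 < e -> exists k, dX x (s k) < e.
Proof.
have /choice[l lP] : forall n : nat, exists l : seq X,
    forall x, exists2 i, (i < size l)%N & dX x (nth x0 l i) < inv_succ n.
  by move=> n; apply: metric_net; exact: inv_succ_gt0.
(* All the nets are enumerated in one sequence through codes of pairs; numbers that code no pair are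
   sent to [x0]. *)
exists (fun k => if unpickle k is Some (n, i) then nth x0 (l n) i else x0).
move=> x e e0.
have [n ne] := inv_succ_lt e0.
have [i _ xi] := lP n x.
by exists (pickle (n, i)); rewrite pickleK; exact: lt_trans xi ne.
Qed.

Lemma metric_open_ball x r : metric_open dX [set y | dX x y < r].
Proof.
have [_ _ sym tri] := metX.
move=> y /= xy; exists (r - dX x y); split; first by rewrite subr_gt0.
by move=> z /=; rewrite ltrBrDl; exact: le_lt_trans.
Qed.

Lemma metric_open_measurable A : metric_open dX A -> measurable A.
Proof. by move=> oA; rewrite borX; exact: sub_sigma_algebra. Qed.

Lemma measurable_metric_ball x r : measurable [set y | dX x y < r].
Proof. exact/metric_open_measurable/metric_open_ball. Qed.

(** By separability, the sublevel set is a countable union of conditions on [f] and [g] separately: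
    [f w] is within [inv_succ n] of a dense point and [g w] within [r - inv_succ n] of it. *)
Lemma measurable_dist d' (W : measurableType d') (f g : W -> X) :
  measurable_fun setT f -> measurable_fun setT g ->
  measurable_fun setT (fun w => dX (f w) (g w)).
Proof.
have [_ _ sym tri] := metX.
move=> mf mg; have [[w0]|noW] := pselect (inhabited W); last first.
  by move=> _ A _; rewrite (_ : _ `&` _ = set0)//; apply/seteqP; split => // w; case: noW.
have [s sP] := metric_separable (f w0).
apply: (measurability _ (RGenInftyO.measurableE R)).
move=> _ [_ [r ->] <-]; rewrite setTI.
rewrite (_ : _ @^-1` _ = \bigcup_k \bigcup_n
    (f @^-1` [set y | dX (s k) y < inv_succ n] `&`
     g @^-1` [set y | dX (s k) y < r - inv_succ n])).
  apply: bigcupT_measurable => k; apply: bigcupT_measurable => n.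
  by apply: measurableI; rewrite -[X in measurable X]setTI;
    [apply: mf|apply: mg] => //; exact: measurable_metric_ball.
apply/seteqP; split => [w /=|w [k _ [n _ [/= fw gw]]]]; rewrite in_itv /=.
  move=> fgr; have [n nr] : exists n, inv_succ n < (r - dX (f w) (g w)) / 2.
    by apply: inv_succ_lt; rewrite divr_gt0// subr_gt0.
  have n0 := inv_succ_gt0 R n.
  have [k fk] := sP (f w) _ n0; exists k => //; exists n => //; split => /=.
    by rewrite sym.
  have := tri (s k) (f w) (g w); rewrite (sym (s k) (f w)); lra.
have := tri (f w) (s k) (g w); rewrite (sym (f w) (s k)); lra.
Qed.

(** * Supports of measures *)

Definition msupport (m : set X -> \bar R) :=
  [set x | forall e : R, 0 < e -> m [set y | dX x y < e] != 0%E].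

Lemma measurable_msupport (m : {measure set X -> \bar R}) : measurable (msupport m).
Proof.
have [_ _ sym tri] := metX.
rewrite -[msupport m]setCK; apply: measurableC; apply: metric_open_measurable => x.
move=> /existsNP[e /not_implyP[e0 /negP]]; rewrite negbK => /eqP me.
exists (e / 2); split => [|y /= xy]; first by rewrite divr_gt0.
move=> /(_ (e / 2)); rewrite divr_gt0// => /(_ isT)/negP; apply; apply/eqP.
apply: subset_measure0 me; try exact: measurable_metric_ball.
by move=> z /= yz; have := tri x y z; lra.
Qed.

(** The complement is covered by the null balls with dense centres [s k] and radii [inv_succ n],
    which are countably many. In [N k n], the first condition empties the set when the ball is not
    null. *)
Lemma msupportC0 (m : {measure set X -> \bar R}) : m (~` msupport m) = 0%E.
Proof.
have [_ _ sym tri] := metX.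
have [[x0]|noX] := pselect (inhabited X); last first.
  by rewrite (_ : ~` _ = set0)//; apply/seteqP; split => // x; case: noX.
have [s sP] := metric_separable x0.
apply/negligibleP; first exact/measurableC/measurable_msupport.
pose N k n := [set y : X | m [set y | dX (s k) y < inv_succ n] = 0%E /\
  dX (s k) y < inv_succ n].
apply: (@negligibleS _ _ _ _ (\bigcup_k \bigcup_n N k n)); last first.
  apply: negligible_bigcup => k; apply: negligible_bigcup => n.
  have [m0|m0] := pselect (m [set y | dX (s k) y < inv_succ n] = 0%E).
    exists [set y | dX (s k) y < inv_succ n]; split => //.
      exact: measurable_metric_ball.
    by move=> y [].
  by rewrite (_ : N k n = set0); [exact: negligible_set0|apply/seteqP; split => // y []].
move=> x /existsNP[e /not_implyP[e0 /negP]]; rewrite negbK => /eqP me.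
have [n ne] : exists n, inv_succ n < e / 2.
  by apply: inv_succ_lt; rewrite divr_gt0.
have n0 := inv_succ_gt0 R n.
have [k xk] := sP x _ n0; exists k => //; exists n => //; split; last by rewrite sym.
apply: subset_measure0 me; try exact: measurable_metric_ball.
by move=> z /= yz; have := tri x (s k) z; lra.
Qed.

Lemma msupport_nonempty (P : probability X R) : msupport P !=set0.
Proof.
apply/set0P/eqP => S0; have : P setT = 0%E by rewrite -setC0 -S0; exact: msupportC0.
by rewrite probability_setT => /eqP; rewrite onee_eq0.
Qed.

(** Centres are confined to [S] because the two measures will be compared only for centres in the
    supports. The index type is free, so that an intersection is indexed by a sum of types and the
    whole space by [void]. *)
Definition ball_meet (S : set X) (A : set X) := exists (I : finType) (t : I -> X) (r : I -> R),
  (forall i, S (t i)) /\ A = [set x | forall i, dX (t i) x < r i].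

Lemma ball_meet_measurable S A : ball_meet S A -> measurable A.
Proof.
move=> [I [t [r [_ ->]]]].
rewrite (_ : [set x | _] = \bigcap_(i in [set: I]) [set x | dX (t i) x < r i]); last first.
  by apply/seteqP; split => x /= h i; [move=> _|]; exact: h.
by apply: fin_bigcap_measurable => // i _; exact: measurable_metric_ball.
Qed.

Lemma ball_meetI S A B : ball_meet S A -> ball_meet S B -> ball_meet S (A `&` B).
Proof.
move=> [I [t [r [St ->]]]] [J [u [q [Su ->]]]].
exists (I + J)%type, (fun k => match k with inl i => t i | inr j => u j end),
  (fun k => match k with inl i => r i | inr j => q j end); split; first by case.
apply/seteqP; split => [x [h1 h2] [i|j]|x h] /=; [exact: h1|exact: h2|].
by split => i; [exact: (h (inl i))|exact: (h (inr i))].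
Qed.

Lemma ball_meetT S : ball_meet S setT.
Proof.
by exists void, (@of_void X), (@of_void R); split;
  [case|apply/seteqP; split => // x _ []].
Qed.

(** A dense sequence of the space may miss [S], so a point of [S] is chosen in each small ball
    around [s k] that meets [S], and [x0] serves in all other cases. *)
Lemma dense_subset (S : set X) (x0 : X) : S x0 ->
  exists c : nat -> X, (forall k, S (c k)) /\
    forall x (e : R), S x -> 0 < e -> exists k, dX x (c k) < e.
Proof.
have [_ _ sym tri] := metX.
move=> Sx0; have [s sP] := metric_separable x0.
have /choice[c cP] : forall kn : nat * nat, exists y, S y /\
    ((exists2 z, S z & dX z (s kn.1) < inv_succ kn.2) -> dX y (s kn.1) < inv_succ kn.2).
  move=> [k n] /=; have [[z Sz zk]|no] := pselect (exists2 z, S z & dX z (s k) < inv_succ n).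
    by exists z.
  by exists x0; split.
exists (fun j => if unpickle j is Some kn then c kn else x0); split => [j|x e Sx e0].
  by case: unpickle => // kn; have [] := cP kn.
have [n ne] : exists n, inv_succ n < e / 2.
  by apply: inv_succ_lt; rewrite divr_gt0.
have n0 := inv_succ_gt0 R n.
have [k xk] := sP x _ n0; exists (pickle (k, n)); rewrite pickleK.
have [_ /(_ (ex_intro2 _ _ x Sx xk)) /= ck] := cP (k, n).
by have := tri x (s k) (c (k, n)); rewrite (sym (s k)); lra.
Qed.

(* Finite intersections of balls centred in [S] generate the Borel sets only
   modulo the complement of [S], hence the enlarged pi-system [G]. *)
Lemma eq_measure_ball_meet (S : set X) (m1 m2 : {measure set X -> \bar R}) :
  measurable S -> S !=set0 -> m1 (~` S) = 0%E -> m2 (~` S) = 0%E ->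
  (m1 setT < +oo)%E ->
  (forall A, ball_meet S A -> m1 A = m2 A) ->
  forall A, measurable A -> m1 A = m2 A.
Proof.
have [_ _ sym tri] := metX.
move=> mS [x0 Sx0] m1S m2S m1oo m12.
pose G := [set A | measurable A /\ exists2 A', ball_meet S A' & A `&` S = A' `&` S].
have restrict (m : {measure set X -> \bar R}) A : m (~` S) = 0%E -> measurable A ->
    m A = m (A `&` S).
  move=> m0 mA; rewrite -{1}[A]setIT -(setUv S) setIUr measureU0//; try exact: measurableI.
    by apply: measurableI => //; exact: measurableC.
  by apply: subset_measure0 m0 => //; [apply: measurableI => //|]; exact: measurableC.
have Gm : G `<=` measurable by move=> A [].
have [c [Sc cP]] := dense_subset Sx0.
have GE : @measurable d X = <<s G >>.
  apply/seteqP; split; last first.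
    by apply: smallest_sub; [exact: sigma_algebra_measurable|exact: Gm].
  rewrite borX; apply: smallest_sub; first exact: smallest_sigma_algebra.
  move=> O oO.
  pose B k n := [set y | dX (c k) y < inv_succ n].
  pose F k n := if pselect (B k n `<=` O) then B k n `&` S else set0.
  have GF k n : G (F k n).
    rewrite /F; case: pselect => /= _; last first.
      split => //; exists set0; rewrite ?set0I//.
      (* The empty set is the ball of radius zero. *)
      exists unit, (fun=> x0), (fun=> 0); split => //; apply/seteqP; split => // x /(_ tt) /=.
      by rewrite ltNge; have [-> //] := metX.
    split; first by apply: measurableI => //; exact: measurable_metric_ball.
    exists (B k n); last by rewrite -setIA setIid.
    exists unit, (fun=> c k), (fun=> inv_succ n); split => //.
    by apply/seteqP; split => x //= /(_ tt).
  (* Inside [S], the open set is the countable union of the [F k n]; the part outside [S] belongs to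
     [G], having the same trace on [S] as the empty set. *)
  rewrite (_ : O = (O `&` S) `|` (O `&` ~` S)); last by rewrite -setIUr setUv setIT.
  apply: (@measurableU _ (g_sigma_algebraType G)).
    rewrite (_ : _ `&` _ = \bigcup_k \bigcup_n F k n).
      apply: (@bigcupT_measurable _ (g_sigma_algebraType G)) => k.
      apply: (@bigcupT_measurable _ (g_sigma_algebraType G)) => n.
      exact: sub_sigma_algebra.
    apply/seteqP; split => [x [Ox Sx]|x [k _ [n _]]]; last first.
      by rewrite /F; case: pselect => // BO [/BO].
    have [e [e0 eO]] := oO _ Ox.
    have [n ne] : exists n, inv_succ n < e / 2.
      by apply: inv_succ_lt; rewrite divr_gt0.
    have n0 := inv_succ_gt0 R n.
    have [k xk] := cP x _ Sx n0; exists k => //; exists n => //.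
    rewrite /F; case: pselect => [BO|[]] /=; first by split => //=; rewrite /B /= sym.
    by move=> z; rewrite /B /= => kz; apply: eO => /=; have := tri x (c k) z; lra.
  apply: sub_sigma_algebra; split.
    by apply: measurableI; [exact: metric_open_measurable|exact: measurableC].
  exists set0; last by rewrite -setIA setICl setI0 set0I.
  exists unit, (fun=> x0), (fun=> 0); split => //; apply/seteqP; split => // x /(_ tt) /=.
  by rewrite ltNge; have [-> //] := metX.
move=> A0 mA0; apply: (@measure_unique _ _ _ G (fun=> setT) GE _ _ _ m1 m2 _ _ A0 mA0) => //.
- move=> A B [mA [A' bA AE]] [mB [B' bB BE]]; split; first exact: measurableI.
  exists (A' `&` B'); first exact: ball_meetI.
  by rewrite -[S in LHS]setIid setIACA AE BE -setIACA setIid.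
- by move=> _; split => //; exists setT => //; exact: ball_meetT.
- by rewrite bigcup_const.
- move=> A [mA [A' bA AE]]; have mA' := ball_meet_measurable bA.
  by rewrite restrict// (restrict m2)// AE -restrict// -restrict// m12.
Qed.
End metric.

(** * Events on the distance matrices *)

Lemma prod_indic (R : realType) n (Z : Type) (A : 'I_n -> set Z) (x : 'I_n -> Z) :
  \prod_(j < n) \1_(A j) (x j) = (`[< forall j, A j (x j) >])%:R :> R.
Proof.
case: asboolP => [Ax|/existsNP[j Aj]].
  by rewrite big1// => j _; rewrite indicE mem_set.
by rewrite (bigD1 j)//= indicE memNset// mul0r.
Qed.

Section coloured_balls.
Context {R : realType} {d1 d2 : measure_display}.
Context {X : measurableType d1} {Y : measurableType d2}.
Variables (dX : X -> X -> R) (dY : Y -> Y -> R).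
Hypotheses (metX : is_metric dX) (metY : is_metric dY).
Hypotheses (cptX : metric_compact dX) (cptY : metric_compact dY).
Hypotheses (borX : @measurable d1 X = <<s metric_open dX >>)
  (borY : @measurable d2 Y = <<s metric_open dY >>).
Let Z := (X * Y)%type.

Definition cdist (b : bool) (z z' : Z) : R := if b then dX z.1 z'.1 else dY z.2 z'.2.

Lemma measurable_cdist b d' (W : measurableType d') (f g : W -> Z) :
  measurable_fun setT f -> measurable_fun setT g ->
  measurable_fun setT (fun w => cdist b (f w) (g w)).
Proof.
move=> mf mg; rewrite /cdist; case: b; apply: measurable_dist => //;
 exact: measurableT_comp.
Qed.

Lemma measurable_cdist_lt b d' (W : measurableType d') (f g : W -> Z) (r : R) :
  measurable_fun setT f -> measurable_fun setT g ->
  measurable [set w | cdist b (f w) (g w) < r].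
Proof.
move=> mf mg; rewrite -[X in measurable X]setTI.
have -> : [set w | cdist b (f w) (g w) < r] = (fun w => cdist b (f w) (g w)) @^-1` `]-oo, r[.
  by apply/seteqP; split => w /=; rewrite in_itv.
exact: measurable_cdist.
Qed.

(* [g] selects the colours of the constraints that are imposed *)
Definition cballs l (c : 'I_l -> bool) (r : 'I_l -> R) (u : 'I_l -> Z)
    (g : pred bool) : set Z :=
  [set z | forall i, g (c i) -> cdist (c i) (u i) z < r i].

Lemma measurable_cballs_gen l c r g d' (W : measurableType d')
    (f : 'I_l -> W -> Z) (h : W -> Z) :
  (forall i, measurable_fun setT (f i)) -> measurable_fun setT h ->
  measurable [set w | cballs c r (f ^~ w) g (h w)].
Proof.
move=> mf mh.
rewrite (_ : [set w | _] = \bigcap_(i in [set i | g (c i)])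
    [set w | cdist (c i) (f i w) (h w) < r i]); last first.
  by apply/seteqP; split => w /= hw i; exact: hw.
apply: fin_bigcap_measurable; first exact: finite_finset.
by move=> i _; exact: measurable_cdist_lt.
Qed.

Lemma measurable_cballs l (c : 'I_l -> bool) r u g : measurable (cballs c r u g).
Proof. by apply: (@measurable_cballs_gen _ c r g _ Z (fun i => cst (u i)) id). Qed.

Lemma measurable_cballs_measure l (c : 'I_l -> bool) r g (P : probability Z R) :
  measurable_fun setT (fun u : l.-tuple Z => fine (P (cballs c r (tnth u) g))).
Proof.
apply: measurableT_comp => //.
have mA : measurable [set uz : l.-tuple Z * Z | cballs c r (tnth uz.1) g uz.2].
  apply: (@measurable_cballs_gen _ _ _ _ _ _
    (fun i (uz : l.-tuple Z * Z) => tnth uz.1 i)) => //.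
  by move=> i; apply: (measurableT_comp (measurable_tnth i)).
have := measurable_fun_xsection P mA.
congr (measurable_fun _ _); apply/funext => u /=; congr (P _).
by apply/seteqP; split => z; rewrite /xsection /= inE.
Qed.

Lemma cballs_setI l (c : 'I_l -> bool) r u :
  cballs c r u predT = cballs c r u id `&` cballs c r u negb.
Proof.
apply/seteqP; split => [z h|z [h1 h2] i _]; first by split => i _; exact: h.
by case ci : (c i); rewrite -ci; [apply: h1|apply: h2]; rewrite ci.
Qed.

Lemma cballs0 l (c : 'I_l -> bool) r u : cballs c r u pred0 = setT.
Proof. by apply/seteqP; split. Qed.

Lemma cballsX l (c : 'I_l -> bool) r u :
  exists2 A, measurable A & cballs c r u id = A `*` setT.
Proof.
exists [set x | forall i, c i -> dX (u i).1 x < r i].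
  rewrite (_ : [set x | _] = \bigcap_(i in [set i | c i]) [set x | dX (u i).1 x < r i]).
    apply: fin_bigcap_measurable; first exact: finite_finset.
    by move=> i _; exact: measurable_metric_ball.
  by apply/seteqP; split => w /= hw i; exact: hw.
apply/seteqP; split => [z h|z [h _] i ci] /=; last by rewrite /cdist ci; exact: h.
by split => // i ci; have := h i ci; rewrite /cdist ci.
Qed.

Lemma cballsY l (c : 'I_l -> bool) r u :
  exists2 B, measurable B & cballs c r u negb = setT `*` B.
Proof.
exists [set y | forall i, ~~ c i -> dY (u i).2 y < r i].
  rewrite (_ : [set x | _] = \bigcap_(i in [set i | ~~ c i]) [set y | dY (u i).2 y < r i]).
    apply: fin_bigcap_measurable; first exact: finite_finset.
    by move=> i _; exact: measurable_metric_ball.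
  by apply/seteqP; split => w /= hw i; exact: hw.
apply/seteqP; split => [z h|z [_ h] i ci] /=; last by rewrite /cdist (negbTE ci); exact: h.
by split => // i ci; have := h i ci; rewrite /cdist (negbTE ci).
Qed.

Variables (T : X -> X) (S : Y -> Y).

(** The first [l] sample points act as centres and the last four as test points, the [j]-th one
    being subject to the constraints whose colour [g j] selects. Both iterate indices are zero. *)
Definition cevent l (c : 'I_l -> bool) (r : 'I_l -> R) (g : 'I_4 -> pred bool) :
    set (#|{: midx (l + 4) 1}|.-tuple R) :=
  [set w | forall i j, g j (c i) ->
    tnth w (enum_rank (lshift 4 i, ord0, rshift l j, ord0, c i)) < r i].

Lemma measurable_cevent l (c : 'I_l -> bool) r g : measurable (cevent c r g).
Proof.
rewrite (_ : cevent c r g = \bigcap_(ij in [set ij : 'I_l * 'I_4 | g ij.2 (c ij.1)])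
  [set w : #|{: midx (l + 4) 1}|.-tuple R |
    tnth w (enum_rank (lshift 4 ij.1, ord0, rshift l ij.2, ord0, c ij.1)) < r ij.1]).
  apply: fin_bigcap_measurable; first exact: finite_finset.
  move=> [i j] _ /=; rewrite -[X in measurable X]setTI.
  set k := enum_rank _.
  rewrite (_ : [set w | _] =
      (fun w : #|{: midx (l + 4) 1}|.-tuple R => tnth w k) @^-1` `]-oo, r i[).
    by apply: measurable_tnth => //; exact: measurable_itv.
  by apply/seteqP; split => w /=; rewrite in_itv.
by apply/seteqP; split => w /= h => [[i j] |i j] ?; [exact: h|exact: (h (i, j))].
Qed.

Lemma Phi_cevent l (c : 'I_l -> bool) r g (P : probability Z R) :
  Phi dX dY T S (l + 4) 1 P (cevent c r g) =
  iter_int P (fun u : l.-tuple Z =>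
    (\prod_(j < 4) fine (P (cballs c r (tnth u) (g j))))%:E).
Proof.
rewrite /Phi iter_int_cat; congr iter_int; apply/funext => u.
rewrite -(iter_int_prod_indic P); last by move=> j; exact: measurable_cballs.
congr iter_int; apply/funext => v; congr EFin.
rewrite prod_indic indicE; congr (nat_of_bool _)%:R.
apply/idP/asboolP => [|h].
  rewrite inE /= => h j i gji; have := h i j gji.
  rewrite tnth_mktuple enum_rankK /= /cdist.
  by rewrite tnth_lshift tnth_rshift.
rewrite inE /= => i j gji; have := h j i gji.
by rewrite tnth_mktuple enum_rankK /= /cdist tnth_lshift tnth_rshift.
Qed.

End coloured_balls.

(** * Joinings with the matrix laws of the product *)

Section disjointness.
Context {R : realType} {d1 d2 : measure_display}.
Context {X : measurableType d1} {Y : measurableType d2}.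
Variables (dX : X -> X -> R) (dY : Y -> Y -> R).
Hypotheses (metX : is_metric dX) (metY : is_metric dY).
Hypotheses (cptX : metric_compact dX) (cptY : metric_compact dY).
Hypotheses (borX : @measurable d1 X = <<s metric_open dX >>)
  (borY : @measurable d2 Y = <<s metric_open dY >>).
Variables (mu : probability X R) (nu : probability Y R).
Variables (T : X -> X) (S : Y -> Y).
Let Z := (X * Y)%type.
Variable lam : probability Z R.
Hypothesis lamX : forall A, measurable A -> lam (A `*` setT) = mu A.
Hypothesis lamY : forall B, measurable B -> lam (setT `*` B) = nu B.
Let prod : probability Z R := (mu \x nu)%E.
Hypothesis Phi_eq : forall n : nat, (1 <= n)%N ->
  forall B : set (#|{: midx n 1}|.-tuple R), measurable B ->
    Phi dX dY T S n 1 lam B = Phi dX dY T S n 1 prod B.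

Let prodXY A B : measurable A -> measurable B -> prod (A `*` B) = (mu A * nu B)%E.
Proof. exact: product_measure1E. Qed.

Let prodX A : measurable A -> prod (A `*` setT) = mu A.
Proof. by move=> mA; rewrite prodXY// probability_setT mule1. Qed.

Let prodY B : measurable B -> prod (setT `*` B) = nu B.
Proof. by move=> mA; rewrite prodXY// probability_setT mul1e. Qed.

(** * Moments of the measures of coloured ball intersections *)

Section moments.
Variables (l : nat) (c : 'I_l -> bool) (r : 'I_l -> R).
Let F (u : l.-tuple Z) := cballs dX dY c r (tnth u).
Let a u := fine (lam (F u predT)).
Let b u := fine (prod (F u predT)).

(** Each factor constrains a single coordinate, so it depends on [lam] only through a marginal; two
    test points of opposite colours thus reproduce the product measure. *)
Let lamb u : fine (lam (F u id)) * fine (lam (F u negb)) = b u.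
Proof.
rewrite /b /F cballs_setI.
have [A mA ->] := cballsX dY metX borX c r (tnth u).
have [B mB ->] := cballsY dX metY borY c r (tnth u).
rewrite lamX// lamY// -setXI setIT setTI prodXY//.
by rewrite fineM// fin_num_measure.
Qed.

Let prodb u : fine (prod (F u id)) * fine (prod (F u negb)) = b u.
Proof.
rewrite /b /F cballs_setI.
have [A mA ->] := cballsX dY metX borX c r (tnth u).
have [B mB ->] := cballsY dX metY borY c r (tnth u).
rewrite prodX// prodY// -setXI setIT setTI prodXY//.
by rewrite fineM// fin_num_measure.
Qed.

Let Fmoment (g1 g2 g3 g4 : pred bool) (P : probability Z R) u :=
  fine (P (F u g1)) * fine (P (F u g2)) * fine (P (F u g3)) * fine (P (F u g4)).

(** Both sides are the probability of one event on the matrices, for centres and test points drawn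
    from [lam] or from [prod]. Splitting a test point into two of opposite colours leaves the right
    side unchanged but replaces a factor [a] by [b] on the left. *)
Let moment_eq g1 g2 g3 g4 :
  iter_int lam (fun u => (Fmoment g1 g2 g3 g4 lam u)%:E) =
  iter_int prod (fun u => (Fmoment g1 g2 g3 g4 prod u)%:E).
Proof.
pose g (j : 'I_4) := nth (pred0 : pred bool) [:: g1; g2; g3; g4] j.
have E (P : probability Z R) :
    iter_int P (fun u : l.-tuple Z => (Fmoment g1 g2 g3 g4 P u)%:E) =
    Phi dX dY T S (l + 4) 1 P (cevent c r g).
  rewrite Phi_cevent//; congr iter_int; apply/funext => u.
  by rewrite !big_ord_recl big_ord0 mulr1 /= !mulrA.
by rewrite !E Phi_eq ?addn4//; exact: measurable_cevent.
Qed.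

Let I := iter_int prod (fun u => (b u * b u)%:E).

(** The selector [pred0] pads the moments that involve fewer than four test points. *)
Let F0 (P : probability Z R) u : fine (P (F u pred0)) = 1 :> R.
Proof. by rewrite /F cballs0 probability_setT. Qed.
Let aa : iter_int lam (fun u => (a u * a u)%:E) = I.
Proof.
rewrite /I; have := moment_eq predT predT pred0 pred0; rewrite /Fmoment.
by under eq_fun do rewrite !F0 !mulr1; under [in RHS]eq_fun do rewrite !F0 !mulr1.
Qed.

Let ab : iter_int lam (fun u => (a u * b u)%:E) = I.
Proof.
rewrite /I; have := moment_eq predT id negb pred0; rewrite /Fmoment.
by under eq_fun do rewrite !F0 mulr1 -mulrA lamb;
 under [in RHS]eq_fun do rewrite !F0 mulr1 -mulrA prodb.
Qed.

Let bb : iter_int lam (fun u => (b u * b u)%:E) = I.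
Proof.
rewrite /I; have := moment_eq id negb id negb; rewrite /Fmoment.
by under eq_fun do rewrite lamb -mulrA lamb;
 under [in RHS]eq_fun do rewrite prodb -mulrA prodb.
Qed.

Let ma : measurable_fun setT a.
Proof. exact: measurable_cballs_measure. Qed.
Let mb : measurable_fun setT b.
Proof. exact: measurable_cballs_measure. Qed.
Let a0 u : 0 <= a u. Proof. exact: fine_ge0. Qed.
Let b0 u : 0 <= b u. Proof. exact: fine_ge0. Qed.

(* [a^2 + b^2 = ab + ab + (a - b)^2], and the integrals of [a^2], [ab] and [b^2]
   all agree. *)
Lemma iter_ae_cballs_eq : iter_ae lam (fun u : l.-tuple Z => a u = b u).
Proof.
have mM (f g : l.-tuple Z -> R) : measurable_fun setT f -> measurable_fun setT g ->
    measurable_fun setT (fun u => (f u * g u)%:E).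
  by move=> mf mg; apply/measurable_EFinP; exact: measurable_funM.
have mab : measurable_fun setT (fun u => a u - b u) by exact: measurable_funB.
(* Finiteness permits cancelling [I + I] in the extended reals. *)
have Ifin : I \is a fin_num.
  rewrite -bb ge0_fin_numE; last by apply: iter_int_ge0 => u; rewrite lee_fin mulr_ge0.
  apply: (@le_lt_trans _ _ 1%E); last exact: ltry.
  apply: iter_int_le1 => [|u|u]; [exact: mM|by rewrite lee_fin mulr_ge0|].
  have b1 : b u <= 1.
    rewrite -lee_fin /b fineK ?fin_num_measure//; last exact: measurable_cballs.
    by rewrite probability_le1//; exact: measurable_cballs.
  by rewrite lee_fin mulr_ile1.
have D0 : iter_int lam (fun u => ((a u - b u) * (a u - b u))%:E) = 0%E.
  have : (I + I = I + I + iter_int lam (fun u => ((a u - b u) * (a u - b u))%:E))%E.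
    rewrite -{1}aa -{1}bb -iter_intD; first last.
    - by move=> u; rewrite lee_fin mulr_ge0.
    - by move=> u; rewrite lee_fin mulr_ge0.
    - exact: mM.
    - exact: mM.
    rewrite -{1 2}ab -iter_intD; first last.
    - by move=> u; rewrite lee_fin mulr_ge0.
    - by move=> u; rewrite lee_fin mulr_ge0.
    - exact: mM.
    - exact: mM.
    rewrite -iter_intD; first last.
    - by move=> u; rewrite lee_fin -expr2 sqr_ge0.
    - by move=> u; rewrite -EFinD lee_fin addr_ge0// mulr_ge0.
    - exact: mM.
    - by apply: emeasurable_funD; exact: mM.
    congr iter_int; apply/funext => u; rewrite -!EFinD; congr EFin; ring.
  case: (iter_int lam _) => [x| |]; rewrite -(fineK Ifin) //= => -[h].
  congr EFin; lra.
have sq0 u : (0 <= ((a u - b u) * (a u - b u))%:E)%E by rewrite lee_fin -expr2 sqr_ge0.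
apply: iter_ae_sub (iter_int_eq0 (mM _ _ mab mab) sq0 D0) => u.
by case=> /eqP; rewrite mulf_eq0 orbb subr_eq0 => /eqP.
Qed.

End moments.

(** The coordinate of [t] of colour [b] lies in the support of the corresponding marginal, expressed
    through cylinders. *)
Let Z_supp b (t : Z) := forall e, 0 < e -> lam [set z | cdist dX dY b t z < e] != 0%E.

(* Shrinking the radii by [2 * 4^-k] while moving the centres by less than
   [4^-k] makes the sets increase with [k]. *)
Lemma cballs_eq l (c : 'I_l -> bool) (r : 'I_l -> R) (t : 'I_l -> Z) :
  (forall i, Z_supp (c i) (t i)) ->
  lam (cballs dX dY c r t predT) = prod (cballs dX dY c r t predT).
Proof.
move=> tsupp.
(* Monotonicity of the sets below requires [3 * e k.+1 <= e k], which the ratio 1/4 ensures. *)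
pose e k : R := 4^-1 ^+ k.
have e0 k : 0 < e k by rewrite exprn_gt0// invr_gt0.
have eS k : e k.+1 = e k / 4 by rewrite /e exprSr.
have ele k : e k <= inv_succ k.
  rewrite /e /inv_succ exprVn lef_pV2 ?posrE ?exprn_gt0// -natrX ler_nat.
  exact: ltn_expl.
have edec k j : (k <= j)%N -> e j <= e k.
  move=> /subnK <-; elim: (j - k)%N => // n IH.
  by rewrite addSn eS; apply: le_trans IH; have := e0 (n + k)%N; lra.
have tri b x y z : cdist dX dY b x z <= cdist dX dY b x y + cdist dX dY b y z.
  by rewrite /cdist; case: b; [case: metX|case: metY] => _ _ _; exact.
have sym b x y : cdist dX dY b x y = cdist dX dY b y x.
  by rewrite /cdist; case: b; [case: metX|case: metY] => _ _ + _; exact.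
have /choice[u uP] k : exists u : l.-tuple Z,
    (forall i, cdist dX dY (c i) (t i) (tnth u i) < e k) /\
    lam (cballs dX dY c (fun i => r i - 2 * e k) (tnth u) predT) =
    prod (cballs dX dY c (fun i => r i - 2 * e k) (tnth u) predT).
  have [u [u1 u2]] := iter_ae_meets
    (V := fun i => [set z | cdist dX dY (c i) (t i) z < e k])
    (fun i => measurable_cdist_lt metX metY cptX cptY borX borY (c i) (e k)
       (measurable_cst (t i)) (@measurable_id _ _ _))
    (fun i => tsupp i _ (e0 k))
    (iter_ae_cballs_eq c (fun i => r i - 2 * e k)).
  exists u; split => //.
  have := congr1 EFin u2; rewrite !fineK// fin_num_measure//;
    exact: measurable_cballs.
pose E k := cballs dX dY c (fun i => r i - 2 * e k) (tnth (u k)) predT.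
have mE k : measurable (E k) by exact: measurable_cballs.
have E_bigcup : \bigcup_k E k = cballs dX dY c r t predT.
  apply/seteqP; split => [z [k _ Ekz] i _|z Ez].
    have [/(_ i) tu _] := uP k; have := Ekz i isT; have := tri (c i) (t i) (tnth (u k) i) z.
    have := e0 k; lra.
  (* The factor 3 pays for the shrinking of the radius by [2 * e k] and the move of the centre by
     [e k]; the maximum of the [k i] then works for all constraints at once. *)
  have /choice[k kP] i : exists k, cdist dX dY (c i) (t i) z + 3 * e k < r i.
    have [|k ke] := @inv_succ_lt R ((r i - cdist dX dY (c i) (t i) z) / 3).
      by rewrite divr_gt0// subr_gt0; exact: Ez.
    by exists k; have := ele k; lra.
  exists (\max_i k i)%N => // i _.
  have [/(_ i) tu _] := uP (\max_i k i)%N; rewrite sym in tu.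
  have := edec _ _ (leq_bigmax i : (k i <= \max_i k i)%N).
  have := tri (c i) (tnth (u (\max_i k i)%N) i) (t i) z; have := kP i; lra.
have E_homo : {homo E : n m / (n <= m)%N >-> (n <= m)%O}.
  apply/nondecreasing_seqP => k; apply/subsetPset => z Ez i _.
  have [/(_ i) tu _] := uP k; rewrite sym in tu.
  have [/(_ i) tu' _] := uP k.+1.
  have := tri (c i) (tnth (u k.+1) i) (t i) z.
  have := tri (c i) (t i) (tnth (u k) i) z.
  have := Ez i isT; rewrite (sym _ (tnth (u k.+1) i) (t i)) (sym _ (t i) (tnth (u k) i)).
  have := e0 k; rewrite eS in tu' *; lra.
have mE' : measurable (\bigcup_k E k) by exact: bigcupT_measurable.
rewrite -E_bigcup.
have cvg1 := nondecreasing_cvg_mu (mu := lam) mE mE' E_homo.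
have cvg2 := nondecreasing_cvg_mu (mu := prod) mE mE' E_homo.
rewrite (_ : lam \o E = prod \o E) in cvg1.
  by rewrite -(cvg_lim _ cvg1)// -(cvg_lim _ cvg2).
by apply/funext => k; have [_] := uP k.
Qed.

Let SX := msupport dX mu.
Let SY := msupport dY nu.

Lemma ball_meet_prod A B : ball_meet dX SX A -> ball_meet dY SY B ->
  lam (A `*` B) = prod (A `*` B).
Proof.
have [x0 _] : SX !=set0 by exact: msupport_nonempty.
have [y0 _] : SY !=set0 by exact: msupport_nonempty.
move=> [I [t [r [St ->]]]] [J [t' [r' [St' ->]]]].
pose l := #|{: I + J}|.
pose c (i : 'I_l) := if enum_val i is inl _ then true else false.
pose q (i : 'I_l) := match enum_val i with inl i => r i | inr j => r' j end.
(* The coordinates [y0] and [x0] are fillers: the colour [c i] makes [cdist] ignore them. *)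
pose w (i : 'I_l) : Z := match enum_val i with inl i => (t i, y0) | inr j => (x0, t' j) end.
have -> : [set x | forall i, dX (t i) x < r i] `*` [set y | forall j, dY (t' j) y < r' j] =
    cballs dX dY c q w predT.
  apply/seteqP; split => [z [/= h1 h2] i _|z h].
    by rewrite /c /q /w; case: (enum_val i) => k; [exact: h1|exact: h2].
  split => i /=.
    by have := h (enum_rank (inl i)) isT; rewrite /c /q /w enum_rankK.
  by have := h (enum_rank (inr i)) isT; rewrite /c /q /w enum_rankK.
apply: cballs_eq => k e e0; rewrite /c /w; case: (enum_val k) => i.
  rewrite (_ : [set z | _] = [set x | dX (t i) x < e] `*` setT).
    by rewrite lamX; [exact: St|exact: measurable_metric_ball].
  by apply/seteqP; split => z //= [].
rewrite (_ : [set z | _] = setT `*` [set x | dY (t' i) x < e]).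
  by rewrite lamY; [exact: St'|exact: measurable_metric_ball].
by apply/seteqP; split => z //= [].
Qed.

(** * From rectangles of ball intersections to all measurable sets *)

Let slice1 (P : probability Z R) B (mB : measurable B) :=
  pushforward (mrestr P (measurableX (@measurableT _ X) mB)) (fst : Z -> X).

Let slice1E P B mB A : @slice1 P B mB A = P (A `*` B).
Proof.
rewrite /slice1 /pushforward /mrestr; congr (P _).
by apply/seteqP; split => z [//= ? []].
Qed.

Let slice2 (P : probability Z R) A (mA : measurable A) :=
  pushforward (mrestr P (measurableX mA (@measurableT _ Y))) (snd : Z -> Y).

Let slice2E P A mA B : @slice2 P A mA B = P (A `*` B).
Proof.
rewrite /slice2 /pushforward /mrestr; congr (P _).
by apply/seteqP; split => z [//= ? []].
Qed.

Let prob_setX0 (P : probability Z R) A B :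
  (forall A, measurable A -> P (A `*` setT) = mu A) ->
  measurable A -> measurable B -> mu A = 0%E -> P (A `*` B) = 0%E.
Proof.
move=> PX mA mB A0; have := PX _ mA; rewrite A0 => PA0.
apply: subset_measure0 PA0; try exact: measurableX.
by move=> z [].
Qed.

Let prob_setX0r (P : probability Z R) A B :
  (forall B, measurable B -> P (setT `*` B) = nu B) ->
  measurable A -> measurable B -> nu B = 0%E -> P (A `*` B) = 0%E.
Proof.
move=> PX mA mB A0; have := PX _ mB; rewrite A0 => PA0.
apply: subset_measure0 PA0; try exact: measurableX.
by move=> z [].
Qed.

(** With one side of the rectangle fixed, its measure is a measure in the other side, concentrated
    on the support of the marginal. So [eq_measure_ball_meet] frees first [A], then [B], and
    rectangles determine the product measure. *)
Lemma joining_eq_prod C : measurable C -> lam C = prod C.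
Proof.
have mSX : measurable SX by exact: measurable_msupport.
have mSY : measurable SY by exact: measurable_msupport.
have SX0 : mu (~` SX) = 0%E by exact: msupportC0.
have SY0 : nu (~` SY) = 0%E by exact: msupportC0.
have step1 A B : measurable A -> ball_meet dY SY B -> lam (A `*` B) = prod (A `*` B).
  move=> mA bB; have mB : measurable B by exact: ball_meet_measurable bB.
  rewrite -(slice1E _ mB) -(slice1E prod mB).
  apply: (eq_measure_ball_meet metX cptX borX mSX) => //.
  - exact: msupport_nonempty.
  - by rewrite [LHS]slice1E//; refine (prob_setX0 lamX _ _ _) => //; exact: measurableC.
  - by rewrite [LHS]slice1E//; refine (prob_setX0 prodX _ _ _) => //; exact: measurableC.
  - rewrite [ltLHS]slice1E//; apply: le_lt_trans (ltry 1).
    by apply: probability_le1; exact: measurableX.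
  - by move=> A' bA'; rewrite [LHS]slice1E// [RHS]slice1E//; exact: ball_meet_prod.
have step2 A B : measurable A -> measurable B -> lam (A `*` B) = prod (A `*` B).
  move=> mA mB.
  rewrite -(slice2E _ mA) -(slice2E prod mA).
  apply: (eq_measure_ball_meet metY cptY borY mSY) => //.
  - exact: msupport_nonempty.
  - by rewrite [LHS]slice2E//; refine (prob_setX0r lamY _ _ _) => //; exact: measurableC.
  - by rewrite [LHS]slice2E//; refine (prob_setX0r prodY _ _ _) => //; exact: measurableC.
  - rewrite [ltLHS]slice2E//; apply: le_lt_trans (ltry 1).
    by apply: probability_le1; exact: measurableX.
  - by move=> B' bB'; rewrite [LHS]slice2E// [RHS]slice2E//; exact: step1.
move=> mC; apply/esym/product_measure_unique => // A B mA mB.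
exact: (etrans (step2 _ _ mA mB) (prodXY mA mB)).
Qed.

End disjointness.

(** * Matrix law of a kernel space *)

Section matrix_law.
Context {R : realType}.

(** The diagonal is read from the marks, since identities of kernels that hold almost everywhere on
    the square say nothing there. *)
Definition kmat (K : mcks R) (n m : nat) (z : n.-tuple (mcks_car K)) :
    #|{: midx n m}|.-tuple R :=
  [tuple let: (i, a, j, b, c) := enum_val k in
     if i == j then mcks_mark (c, a : nat, b : nat) (tnth z i)
     else mcks_ker (c, a : nat, b : nat) (tnth z i) (tnth z j)
   | k < #|{: midx n m}|].
Arguments kmat : clear implicits.

Definition klaw (K : mcks R) n m (B : set (#|{: midx n m}|.-tuple R)) : \bar R :=
  iter_int (mcks_P K) (fun z => (\1_(kmat K n m @^-1` B) z)%:E).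

Definition measurable_mcks (K : mcks R) : Prop :=
  (forall i, measurable_fun setT (@mcks_mark R K i)) /\
  (forall i, measurable_fun setT
     (fun q : (mcks_car K * mcks_car K)%type => mcks_ker i q.1 q.2)).

Lemma measurable_kmat K n m : measurable_mcks K -> measurable_fun setT (kmat K n m).
Proof.
move=> [mm mk]; apply/measurable_fun_tnthP => k.
rewrite (_ : _ \o _ = fun z : n.-tuple (mcks_car K) => let: (i, a, j, b, c) := enum_val k in
     if i == j then mcks_mark (c, a : nat, b : nat) (tnth z i)
     else mcks_ker (c, a : nat, b : nat) (tnth z i) (tnth z j)); last first.
  by apply/funext => z /=; rewrite tnth_mktuple.
case: (enum_val k) => [[[[i a] j] b] c]; case: eqP => _.
  by apply: (measurableT_comp (mm _)); exact: measurable_tnth.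
apply: (measurableT_comp (mk (c, a : nat, b : nat))
  (g := fun z : n.-tuple (mcks_car K) => (tnth z i, tnth z j))).
by apply: measurable_fun_pair; exact: measurable_tnth.
Qed.

(** Each of the finitely many entries is a mark at one coordinate or a kernel at two distinct ones,
    so [p] preserves them all for almost every tuple. This covers both quotient maps and kernel
    isomorphisms. *)
Lemma klaw_transfer (K K' : mcks R) (p : mcks_car K -> mcks_car K') :
  measurable_mcks K -> measurable_mcks K' -> measurable_fun setT p ->
  (forall A, measurable A -> mcks_P K' A = mcks_P K (p @^-1` A)) ->
  (forall i, {ae mcks_P K, forall z, mcks_mark i (p z) = mcks_mark i z}) ->
  (forall i, {ae (mcks_P K \x mcks_P K)%E, forall zw,
     mcks_ker i (p zw.1) (p zw.2) = mcks_ker i zw.1 zw.2}) ->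
  forall n m (B : set (#|{: midx n m}|.-tuple R)), measurable B -> klaw K' B = klaw K B.
Proof.
move=> mK mK' mp pP pmark pker n m B mB.
have mI (Q : mcks R) : measurable_mcks Q ->
    measurable_fun setT (fun z : n.-tuple (mcks_car Q) => (\1_(kmat Q n m @^-1` B) z : R)%:E).
  move=> mQ; apply/measurable_EFinP; apply: measurable_indic.
  by rewrite -[X in measurable X]setTI; exact: measurable_kmat.
rewrite /klaw (iter_int_pushforward mp pP (mI _ mK'))//.
apply: ae_eq_iter_int => //.
- apply: (measurableT_comp (mI _ mK')).
  apply/measurable_fun_tnthP => i.
  rewrite (_ : _ \o _ = fun t => p (tnth t i)); last first.
    by apply/funext => t /=; rewrite tnth_map.
  by apply: (measurableT_comp mp); exact: measurable_tnth.
- exact: mI.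
have : iter_ae (mcks_P K) (fun t : n.-tuple (mcks_car K) => forall k,
    tnth (kmat K' n m [tuple of map p t]) k = tnth (kmat K n m t) k).
  apply: iter_ae_forall => k; under eq_fun do rewrite !tnth_mktuple.
  case: (enum_val k) => [[[[i a] j] b] c]; case: (eqVneq i j) => [_|ij].
    apply: iter_ae_sub (iter_ae_tnth i (pmark (c, a : nat, b : nat))) => t.
    by rewrite tnth_map.
  apply: iter_ae_sub (iter_ae_tnth2 ij (P := fun z w =>
    mcks_ker (c, a : nat, b : nat) (p z) (p w) =
    mcks_ker (c, a : nat, b : nat) z w) (pker _)) => t.
  by rewrite !tnth_map.
apply: iter_ae_sub => t /eq_from_tnth kE.
rewrite !indicE; congr ((nat_of_bool _)%:R)%:E.
by apply/idP/idP; rewrite !inE /= kE.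
Qed.

End matrix_law.

(** * The kernel space of a joining *)

Section kernel_space.
Context {R : realType} {d1 d2 : measure_display}.
Context {X : measurableType d1} {Y : measurableType d2}.
Variables (dX : X -> X -> R) (dY : Y -> Y -> R).
Variables (T : X -> X) (S : Y -> Y).

(** In [K_of] the kernel at a pair [(z, z)] is the mark at [z], so the case distinction in [kmat]
    disappears. *)
Lemma Phi_klaw n m (lam : probability (X * Y)%type R) B :
  Phi dX dY T S n m lam B = klaw (K_of dX dY T S lam) B.
Proof.
rewrite /Phi /klaw /=; congr iter_int; apply/funext => z.
congr (\1_(_ @^-1` B) z)%:E; apply/funext => t; apply: eq_from_tnth => k.
rewrite !tnth_mktuple; case: (enum_val k) => [[[[i a] j] b] c].
by case: eqVneq => [->|].
Qed.

Variables (mu : probability X R) (nu : probability Y R).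
Hypotheses (sysX : cmmps dX mu T) (sysY : cmmps dY nu S).
Variable lam : probability (X * Y)%type R.

Lemma measurable_K_of : measurable_mcks (K_of dX dY T S lam).
Proof.
have [metX cptX borX mT _] := sysX; have [metY cptY borY mS _] := sysY.
have mTn a : measurable_fun setT (iter a T).
  by elim: a => [|a IH]; [exact: measurable_id|exact: (measurableT_comp mT IH)].
have mSn a : measurable_fun setT (iter a S).
  by elim: a => [|a IH]; [exact: measurable_id|exact: (measurableT_comp mS IH)].
split => -[[[] a] b] /=.
- by apply: measurable_dist => //;
    [apply: (measurableT_comp (mTn a))|apply: (measurableT_comp (mTn b))].
- by apply: measurable_dist => //;
    [apply: (measurableT_comp (mSn a))|apply: (measurableT_comp (mSn b))].
- apply: measurable_dist => //;
    [apply: (measurableT_comp (mTn a))|apply: (measurableT_comp (mTn b))];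
  exact: measurableT_comp.
- apply: measurable_dist => //;
    [apply: (measurableT_comp (mSn a))|apply: (measurableT_comp (mSn b))];
  exact: measurableT_comp.
Qed.

Hypothesis lamX : forall A, measurable A -> lam (A `*` setT) = mu A.
Hypothesis lamY : forall B, measurable B -> lam (setT `*` B) = nu B.

Lemma twin_free_K_of : twin_free (K_of dX dY T S lam).
Proof.
have [metX cptX borX _ _] := sysX; have [metY cptY borY _ _] := sysY.
have mSX : measurable (msupport dX mu) by exact: measurable_msupport.
have mSY : measurable (msupport dY nu) by exact: measurable_msupport.
exists ((~` msupport dX mu) `*` setT `|` setT `*` (~` msupport dY nu)); split.
- by apply: measurableU; apply: measurableX => //; exact: measurableC.
- apply: null_set_setU.
  + by apply: measurableX => //; exact: measurableC.
  + by apply: measurableX => //; exact: measurableC.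
  + by rewrite /= lamX; [exact: msupportC0|exact: measurableC].
  + by rewrite /= lamY; [exact: msupportC0|exact: measurableC].
move=> [x y] [x' y'] /= /not_orP[Nx Ny] _ [_ tw].
have xS : msupport dX mu x by apply: contrapT => nx; apply: Nx.
have yS : msupport dY nu y by apply: contrapT => ny; apply: Ny.
congr pair.
- have [ge0 d0 sym tri] := metX; apply: contrapT => xx'.
  (* The ball around [x] of half the distance to [x'] has positive measure, hence contains some
     [w.1] equidistant from both, against the triangle inequality. *)
  have dpos : 0 < dX x x' / 2.
    by rewrite divr_gt0// lt_neqAle ge0 andbT eq_sym; apply/eqP => /d0.
  have mV : measurable ([set w | dX x w < dX x x' / 2] `*` [set: Y]).
    by apply: measurableX => //; exact: measurable_metric_ball.
  have V0 : lam ([set w | dX x w < dX x x' / 2] `*` [set: Y]) != 0%E.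
    by rewrite lamX; [exact: xS|exact: measurable_metric_ball].
  have [w [[/= xw _] [xwE _]]] := ae_meets mV V0 (tw (true, 0%N, 0%N)).
  move: xwE => /= xwE; have := tri x w.1 x'; rewrite (sym w.1) -xwE; lra.
- have [ge0 d0 sym tri] := metY; apply: contrapT => yy'.
  have dpos : 0 < dY y y' / 2.
    by rewrite divr_gt0// lt_neqAle ge0 andbT eq_sym; apply/eqP => /d0.
  have mV : measurable ([set: X] `*` [set w | dY y w < dY y y' / 2]).
    by apply: measurableX => //; exact: measurable_metric_ball.
  have V0 : lam ([set: X] `*` [set w | dY y w < dY y y' / 2]) != 0%E.
    by rewrite lamY; [exact: yS|exact: measurable_metric_ball].
  have [w [[_ /= yw] [ywE _]]] := ae_meets mV V0 (tw (false, 0%N, 0%N)).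
  move: ywE => /= ywE; have := tri y w.2 y'; rewrite (sym w.2) -ywE; lra.
Qed.

Lemma twin_free_quotient_K_of :
  twin_free_quotient (K_of dX dY T S lam) (K_of dX dY T S lam).
Proof.
have [mm mk] := measurable_K_of; split => //; first exact: twin_free_K_of.
exists id; split => //.
- by move=> i; exact: nearW.
- by move=> i; exact: nearW.
Qed.

End kernel_space.

Theorem theorem15 (R : realType) (d1 d2 : measure_display)
  (X : measurableType d1) (Y : measurableType d2)
  (dX : X -> X -> R) (dY : Y -> Y -> R)
  (mu : probability X R) (nu : probability Y R)
  (T : X -> X) (S : Y -> Y) :
  cmmps dX mu T -> cmmps dY nu S ->
  ((forall lam : probability (X * Y)%type R, joining mu nu T S lam ->
      jequiv dX dY T S lam (mu \x nu)%E)
   <->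
   (forall n m : nat, (1 <= n)%N -> (1 <= m)%N ->
      forall lam : probability (X * Y)%type R, joining mu nu T S lam ->
      forall B : set (#|{: midx n m}|.-tuple R), measurable B ->
        Phi dX dY T S n m lam B = Phi dX dY T S n m (mu \x nu)%E B)).
Proof.
move=> sysX sysY; split.
- move=> H n m _ _ lam /H [Q [Q' [[_ Qm Qk [p [mp pP pmark pker]]]
    [_ Qm' Qk' [p' [mp' pP' pmark' pker']]]
    [U [_ [_ [_ [_ [mU _] _ UP [Umark Uker]]]]]]]]] B mB.
  rewrite !Phi_klaw.
  have mK P : measurable_mcks (K_of dX dY T S P) by exact: (measurable_K_of sysX sysY).
  (* The law passes from [lam] to its quotient [Q], from the product to its quotient [Q'], and
     between the quotients along [U]. *)
  rewrite -(klaw_transfer (mK _) (conj Qm Qk) mp pP pmark pker mB).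
  rewrite -(klaw_transfer (mK _) (conj Qm' Qk') mp' pP' pmark' pker' mB).
  by rewrite (klaw_transfer (conj Qm Qk) (conj Qm' Qk') mU UP Umark Uker mB).
- move=> H lam jlam; have [lamX lamY _] := jlam.
  have [metX cptX borX _ _] := sysX; have [metY cptY borY _ _] := sysY.
  have lamE C : measurable C -> lam C = (mu \x nu)%E C.
    by apply: (joining_eq_prod metX metY cptX cptY borX borY lamX lamY
      (T := T) (S := S)) => n n0 B mB; exact: H.
  (* Both kernel spaces are their own quotients and carry the same measure, so the identity is an
     isomorphism. *)
  exists (K_of dX dY T S lam), (K_of dX dY T S (mu \x nu)%E); split.
  + exact: (twin_free_quotient_K_of sysX sysY lamX lamY).
  + apply: (twin_free_quotient_K_of sysX sysY) => A mA.
      exact: (etrans (esym (lamE _ (measurableX mA measurableT))) (lamX _ mA)).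
    exact: (etrans (esym (lamE _ (measurableX measurableT mA))) (lamY _ mA)).
  + exists id, id, setT, setT; split => //.
    * by split => //; rewrite setCT measure0.
    * by move=> B mB; exact/esym/lamE.
    * by split => i; exact: nearW.
Qed.
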